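(* Let $I$ be a proper ideal in a commutative Noetherian ring $A$. Then $$S_I=S_{\bigcap_{P\in\operatorname{MaxAss}_A(A/I)}P}.$$
   Context: For an ideal $L$ of $A$, the regular-denominator set of $L$ is $S_L:=\{a\in A\mid \text{multiplication by } a \text{ on } A/L \text{ is injective}\}=\{a\in A\mid (L:a)=L\}$. $\operatorname{MaxAss}_A(A/I)$ is the set of associated primes of the $A$-module $A/I$ that are maximal with respect to inclusion among the associated primes of $A/I$. *)

(* Defs.v *)
From HB Require Import structures.
From mathcomp Require Import all_boot all_order all_algebra.
From mathcomp Require Import boolp classical_sets.

Set Implicit Arguments.
Unset Strict Implicit.
Unset Printing Implicit Defensive.

Import GRing.Theory.

Local Open Scope classical_set_scope.
Local Open Scope ring_scope.
Local Open Scope quotient_scope.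

(* MathComp's [idealr] only covers proper ideals of nontrivial rings; regular
   denominators are defined for arbitrary ideals, so the unit ideal is allowed
   here and properness is a separate predicate. *)
Definition ideal_axiom (A : comPzRingType) (L : set A) : Prop :=
  [/\ L 0, forall x y, L x -> L y -> L (x + y) & forall a x, L x -> L (a * x)].

Record ideal (A : comPzRingType) := Ideal {
  ideal_set :> set A;
  idealP : ideal_axiom ideal_set
}.

Definition is_proper (A : comPzRingType) (L : ideal A) : Prop :=
  (L : set A) <> setT.

Definition prime_ideal (A : comPzRingType) (P : ideal A) : Prop :=
  is_proper P /\ forall a b, (P : set A) (a * b) -> (P : set A) a \/ (P : set A) b.

Definition ideal_generated (A : comPzRingType) (s : seq A) : set A :=
  [set x | exists c : 'I_(size s) -> A, x = \sum_(i < size s) c i * s`_i].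

Definition noetherian (A : comPzRingType) : Prop :=
  forall L : ideal A, exists s : seq A, (L : set A) = ideal_generated s.

Lemma bigcap_ideal_axiom (A : comPzRingType) (F : set (ideal A)) :
  ideal_axiom (\bigcap_(P in F) (P : set A)).
Proof.
split=> [P _|x y Hx Hy P FP|a x Hx P FP]; case: (idealP P) => P0 PD PM //.
- by apply: PD; [apply: Hx | apply: Hy].
- by apply: PM; apply: Hx.
Qed.

Definition bigcap_ideal (A : comPzRingType) (F : set (ideal A)) : ideal A :=
  Ideal (bigcap_ideal_axiom F).

Section QuotientModule.
Variables (A : comPzRingType) (L : ideal A).

(* [Quotient.quot] expects a boolean predicate. *)
Definition ideal_pred : A -> bool := fun x => `[< (L : set A) x >].

Lemma ideal_pred_zmod_closed : zmod_closed ideal_pred.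
Proof.
case: (idealP L) => L0 LD LM.
split=> [|x y /asboolP Lx /asboolP Ly]; apply/asboolP => //.
by apply: LD => //; rewrite -mulN1r; apply: LM.
Qed.

HB.instance Definition _ :=
  GRing.isZmodClosed.Build A ideal_pred ideal_pred_zmod_closed.

Definition ideal_zmod : zmodClosed A := GRing.ZmodClosed.clone A ideal_pred _.

Definition quotm : Type := Quotient.quot ideal_zmod.

HB.instance Definition _ := GRing.Zmodule.on quotm.
HB.instance Definition _ := EqQuotient.on quotm.

Definition quotm_pi (x : A) : quotm := \pi_quotm x.

Definition quotm_scale (a : A) (u : quotm) : quotm := quotm_pi (a * repr u).

Lemma quotm_piP (x y : A) : quotm_pi x = quotm_pi y <-> (L : set A) (x - y).
Proof.
rewrite /quotm_pi; split=> [/eqP|Lxy].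
  by rewrite -[_ == _]/(_ == _ %[mod Quotient.quot ideal_zmod])
             -Quotient.idealrBE => /asboolP.
apply/eqP; rewrite -[_ == _]/(_ == _ %[mod Quotient.quot ideal_zmod]).
by rewrite -Quotient.idealrBE; apply/asboolP.
Qed.

Lemma quotm_repr (u : quotm) : quotm_pi (repr u) = u.
Proof. exact: reprK. Qed.

Lemma quotm_pi0 : quotm_pi 0 = 0.
Proof. exact: (raddf0 \pi_(Quotient.quot ideal_zmod)). Qed.

Lemma quotm_piD (x y : A) : quotm_pi (x + y) = quotm_pi x + quotm_pi y.
Proof. exact: (raddfD \pi_(Quotient.quot ideal_zmod)). Qed.

Lemma quotm_scale_pi (a x : A) :
  quotm_scale a (quotm_pi x) = quotm_pi (a * x).
Proof.
apply/quotm_piP; rewrite -mulrBr; case: (idealP L) => _ _; apply.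
by apply/quotm_piP; rewrite quotm_repr.
Qed.

Lemma quotm_scaleA a b u :
  quotm_scale a (quotm_scale b u) = quotm_scale (a * b) u.
Proof. by rewrite -[u]quotm_repr !quotm_scale_pi mulrA. Qed.

Lemma quotm_scale1 : left_id 1 quotm_scale.
Proof. by move=> u; rewrite -[u]quotm_repr !quotm_scale_pi mul1r. Qed.

Lemma quotm_scaleDr : right_distributive quotm_scale +%R.
Proof.
move=> a u v; rewrite -[u]quotm_repr -[v]quotm_repr -quotm_piD.
by rewrite !quotm_scale_pi mulrDr quotm_piD.
Qed.

Lemma quotm_scaleDl u : {morph quotm_scale^~ u : a b / a + b}.
Proof.
move=> a b; rewrite -[u]quotm_repr.
by rewrite !quotm_scale_pi mulrDl quotm_piD.
Qed.

HB.instance Definition _ := GRing.Zmodule_isLmodule.Build A quotm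
  quotm_scaleA quotm_scale1 quotm_scaleDr quotm_scaleDl.

Lemma quotm_piZ (a x : A) : quotm_pi (a * x) = a *: quotm_pi x.
Proof. by rewrite -quotm_scale_pi. Qed.

End QuotientModule.

Definition annihilator (A : comPzRingType) (M : lmodType A) (m : M) : set A :=
  [set a | a *: m = 0].

Definition Ass (A : comPzRingType) (M : lmodType A) : set (ideal A) :=
  [set P | prime_ideal P /\ exists m : M, (P : set A) = annihilator m].

Definition MaxAss (A : comPzRingType) (M : lmodType A) : set (ideal A) :=
  [set P | Ass M P /\
    forall Q : ideal A, Ass M Q -> P `<=` Q -> (Q : set A) = P].

Definition regular_denominators (A : comPzRingType) (L : ideal A) : set A :=
  [set a | injective (fun u : quotm L => a *: u)].

Definition colon (A : comPzRingType) (L : ideal A) (a : A) : set A :=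
  [set x | (L : set A) (a * x)].

Lemma regular_denominatorsE (A : comPzRingType) (L : ideal A) :
  regular_denominators L = [set a | colon L a = (L : set A)].
Proof.
have [L0 _ LM] := idealP L.
apply/seteqP; split=> a /= Ha.
- apply/seteqP; split=> x /= Lx; last exact: LM.
  suff /quotm_piP: quotm_pi L x = quotm_pi L 0 by rewrite subr0.
  by apply: Ha; rewrite -!quotm_piZ; apply/quotm_piP; rewrite mulr0 subr0.
- move=> u v; rewrite -[u]quotm_repr -[v]quotm_repr -!quotm_piZ.
  move=> /quotm_piP; rewrite -mulrBr => Luv; apply/quotm_piP.
  by rewrite -Ha.
Qed.

(* Main.v *)
Require Import Defs.
From mathcomp Require Import all_boot all_order all_algebra.
From mathcomp Require Import boolp classical_sets.

(** Both sides are the complement of the union of the primes in [MaxAss (A/I)].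
    For [I], this is because a maximal annihilator of a nonzero element of [A/I]
    is prime. For the intersection [J] of those primes one has to show that an
    element [a] of some [P0] in [MaxAss (A/I)] is a zero divisor modulo [J], for
    which it is enough to find [y] outside [P0] lying in all the other primes.
    The kernel [N] of [A -> (A/I)_P0] is finitely generated, so a single [y]
    outside [P0] satisfies [y N <= I]; if [P = (I : x)] is another maximal
    associated prime then [P] is not contained in [P0], so [x] is in [N], and
    therefore [y] is in [(I : x) = P]. *)

Set Implicit Arguments.
Unset Strict Implicit.
Unset Printing Implicit Defensive.

Import GRing.Theory.

Local Open Scope classical_set_scope.
Local Open Scope ring_scope.

Lemma ideal_generated_mem (A : comPzRingType) (s : seq A) x :
  x \in s -> ideal_generated s x.
Proof.
move=> xs; have ltxs : (index x s < size s)%N by rewrite index_mem.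
exists (fun i => (i == Ordinal ltxs)%:R).
rewrite (bigD1 (Ordinal ltxs)) //= eqxx mul1r nth_index // big1 ?addr0 //.
by move=> i /negbTE ->; rewrite mul0r.
Qed.

Lemma ideal_generated_sub (A : comPzRingType) (s : seq A) (L : set A) :
  ideal_axiom L -> (forall x, x \in s -> L x) -> ideal_generated s `<=` L.
Proof.
move=> [L0 LD LM] sL _ [c ->]; elim/big_ind: _ => // i _.
by apply: LM; apply: sL; rewrite mem_nth.
Qed.

Lemma annihilator_ideal_axiom (A : comPzRingType) (M : lmodType A) (m : M) :
  ideal_axiom (annihilator m).
Proof.
split=> [|x y xm ym|a x xm]; rewrite /annihilator /= ?scale0r //.
- by rewrite scalerDl xm ym addr0.
- by rewrite -scalerA xm scaler0.
Qed.

(** Each entry lies in some member of the chain, and among finitely many members the largest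
    contains the others. *)
Lemma chain_bigcup_seq (T : eqType) (F : set (set T)) (s : seq T) :
  F !=set0 -> total_on F subset -> (forall x, x \in s -> (\bigcup_(X in F) X) x) ->
  exists2 X, F X & forall x, x \in s -> X x.
Proof.
move=> [X0 FX0] tot; elim: s => [|x s IHs] sF; first by exists X0.
have [X FX sX] := IHs (fun y ys => sF y (mem_behead (s := x :: s) ys)).
have [Y FY Yx] := sF x (mem_head x s).
have [XY|YX] := tot X Y FX FY.
- by exists Y => // y; rewrite in_cons => /predU1P[->|/sX /XY].
- by exists X => // y; rewrite in_cons => /predU1P[->|/sX //]; exact: YX.
Qed.

Lemma chain_bigcup_ideal_axiom (A : comPzRingType) (F : set (set A)) :
  F !=set0 -> total_on F subset -> (forall X, F X -> ideal_axiom X) ->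
  ideal_axiom (\bigcup_(X in F) X).
Proof.
move=> F0 tot Fideal; split.
- by have [X FX] := F0; exists X => //; have [] := Fideal X FX.
- move=> x y Fx Fy; have [|X FX sX] := @chain_bigcup_seq _ _ [:: x; y] F0 tot.
    by move=> z; rewrite !inE => /orP[] /eqP ->.
  exists X => //; have [_ XD _] := Fideal X FX.
  by apply: XD; apply: sX; rewrite !inE eqxx ?orbT.
- by move=> a x [X FX Xx]; exists X => //; have [_ _] := Fideal X FX; apply.
Qed.

(** Zorn's lemma applies because the union of a nonempty chain of ideals is finitely generated: its
    generators already lie in one member, which is then the whole union. *)
Lemma noetherian_maximal (A : comPzRingType) (E : set (ideal A)) :
  noetherian A -> E !=set0 ->
  exists2 L, E L & forall K, E K -> L `<=` K -> (K : set A) = L.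
Proof.
move=> noethA [L0 EL0].
(* [Zorn_bigcup] also asks for the union of the empty chain. *)
pose P (X : set A) := X = set0 \/ exists2 L : ideal A, E L & X = L.
have [F FP tot|X [PX Xmax]] := @Zorn_bigcup _ P.
  (* Empty members add nothing to the union, and the remaining ones are ideals in [E]. *)
  pose G := [set X | F X /\ X <> set0].
  have FG : \bigcup_(X in F) X = \bigcup_(X in G) X.
    apply/seteqP; split=> x [X FX Xx]; exists X => //; last by case: FX.
    by split=> // X0; rewrite X0 in Xx.
  have GE X : G X -> exists2 L : ideal A, E L & X = L.
    by move=> [/FP[]].
  have totG : total_on G subset by move=> X Y [FX _] [FY _]; exact: tot.
  rewrite FG; have [->|/set0P G0] := eqVneq G set0; first by left; rewrite bigcup_set0.
  have Gideal X : G X -> ideal_axiom X by move=> /GE[L _ ->]; exact: idealP.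
  have [s /= Us] := noethA (Ideal (chain_bigcup_ideal_axiom G0 totG Gideal)).
  have [|X GX sX] := @chain_bigcup_seq _ _ s G0 totG.
    by move=> x; rewrite Us; exact: ideal_generated_mem.
  right; have [L EL XL] := GE X GX; exists L => //; rewrite -XL.
  apply/seteqP; split=> [|x Xx]; last by exists X.
  by rewrite Us; apply: ideal_generated_sub => //; exact: Gideal.
have {PX} [X0|[L EL XL]] := PX.
  (* The empty set is not maximal, since [L0] contains 0. *)
  exfalso; apply: (Xmax L0); last by right; exists L0.
  rewrite X0; split=> // L00; have [+ _ _] := idealP L0; exact: L00.
exists L => // K EK LK; apply: contrapT => KL; apply: (Xmax K).
  rewrite XL; split=> // KL'; apply: KL; exact/seteqP.
by right; exists K.
Qed.

Lemma annihilator_MaxAss (A : comPzRingType) (M : lmodType A) (a : A) (m : M) :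
  noetherian A -> m <> 0 -> a *: m = 0 -> exists2 P, MaxAss M P & (P : set A) a.
Proof.
move=> noethA m0 am0.
(* Keeping only annihilators above that of [m] forces the prime found to contain [a]. *)
pose E := [set L : ideal A | annihilator m `<=` L /\
  exists2 x : M, x <> 0 & (L : set A) = annihilator x].
have [|P [mP [x x0 Px]] Pmax] := @noetherian_maximal A E noethA.
  by exists (Ideal (annihilator_ideal_axiom m)); split=> //; exists m.
exists P; last exact: mP.
have maxP (y : M) : y <> 0 -> P `<=` annihilator y -> annihilator y = P.
  move=> y0 Py; apply: (Pmax (Ideal (annihilator_ideal_axiom y))) => //.
  by split; [exact: subset_trans Py|exists y].
split; first (split; last by exists x); first split.
- move=> PT; apply: x0; have : (P : set A) 1 by rewrite PT.
  by rewrite Px /annihilator /= scale1r.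
- move=> b c; rewrite Px /annihilator /= -scalerA => bcx.
  (* If [c *: x] is nonzero, its annihilator contains [P], hence equals [P] by maximality, and [b]
     belongs to it. *)
  have [|cx] := pselect (c *: x = 0); [by right|left].
  rewrite -[_ = 0]/(annihilator x b) -Px -(maxP _ cx) // Px => d /= dx.
  by rewrite /annihilator /= scalerA mulrC -scalerA dx scaler0.
- move=> Q [[Qproper _] [y Qy]] PQ; rewrite Qy in PQ *; apply: maxP => // y0.
  by apply: Qproper; rewrite Qy y0; apply/seteqP; split=> // d _; exact: scaler0.
Qed.

Lemma regular_denominators_MaxAss (A : comPzRingType) (I : ideal A) :
  noetherian A ->
  regular_denominators I = ~` \bigcup_(P in MaxAss (quotm I)) (P : set A).
Proof.
move=> noethA; apply/seteqP; split=> a.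
- move=> /= areg [P [[[Pproper _] [m Pm]] _]]; rewrite Pm => am0.
  apply: Pproper; rewrite Pm (_ : m = 0).
    by apply/seteqP; split=> // d _; exact: scaler0.
  by apply: areg; rewrite /= scaler0.
- move=> aP u v /= /eqP; rewrite -subr_eq0 -scalerBr => /eqP auv.
  apply: contrapT => uv; apply: aP.
  have [|P] := annihilator_MaxAss noethA _ auv; last by exists P.
  by move=> /eqP; rewrite subr_eq0 => /eqP.
Qed.

Section LocalizationKernel.
Variables (A : comPzRingType) (I P : ideal A).

(** For [P] prime, this is the kernel of the map from [A] to the localization of [A/I] at [P],
    written without fractions. *)
Definition localization_kernel : set A :=
  [set x | exists2 y, ~ (P : set A) y & (I : set A) (y * x)].

Hypothesis Pprime : prime_ideal P.

Lemma prime_ideal1 : ~ (P : set A) 1.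
Proof.
move=> P1; case: Pprime => + _; apply; apply/seteqP; split=> // x _.
by have [_ _ PM] := idealP P; rewrite -(mulr1 x); exact: PM.
Qed.

Lemma prime_idealNM x y : ~ (P : set A) x -> ~ (P : set A) y -> ~ (P : set A) (x * y).
Proof. by move=> Px Py; have [_ PM] := Pprime; move/PM => []. Qed.

Lemma localization_kernel_ideal_axiom : ideal_axiom localization_kernel.
Proof.
have [I0 ID IM] := idealP I; split.
- by exists 1; [exact: prime_ideal1|rewrite mulr0].
- move=> x x' [y Py Iyx] [y' Py' Iyx']; exists (y * y').
    exact: prime_idealNM.
  rewrite mulrDr; apply: ID; last by rewrite -mulrA; exact: IM.
  by rewrite (mulrC y) -mulrA; exact: IM.
- by move=> a x [y Py Iyx]; exists y; rewrite // mulrCA; exact: IM.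
Qed.

Lemma localization_kernel_uniform : noetherian A ->
  exists2 y, ~ (P : set A) y & localization_kernel `<=` colon I y.
Proof.
move=> noethA; have [I0 ID IM] := idealP I.
have [s /= Ns] := noethA (Ideal localization_kernel_ideal_axiom).
have colonI y : ideal_axiom (colon I y).
  split=> [|x x' Ix Ix'|a x Ix]; rewrite /colon /= ?mulr0 //.
  - by rewrite mulrDr; exact: ID.
  - by rewrite mulrCA; exact: IM.
suff [y Py sy] : exists2 y, ~ (P : set A) y & forall x, x \in s -> colon I y x.
  by exists y => //; rewrite Ns; exact: ideal_generated_sub.
have : forall x, x \in s -> localization_kernel x.
  by move=> x; rewrite Ns; exact: ideal_generated_mem.
(* The uniform multiplier is the product of those of the generators; primality keeps it outside
   [P]. *)
elim: {Ns} s => [_|x s IHs sN]; first by exists 1 => //; exact: prime_ideal1.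
have [y Py sy] := IHs (fun z zs => sN z (mem_behead (s := x :: s) zs)).
have [y' Py' Iyx] := sN x (mem_head x s).
exists (y * y'); first exact: prime_idealNM.
move=> z; rewrite in_cons => /predU1P[->|/sy Iyz]; rewrite /colon /=.
  by rewrite -mulrA; exact: IM.
by rewrite (mulrC y) -mulrA; exact: IM.
Qed.

End LocalizationKernel.

Lemma MaxAss_separation (A : comPzRingType) (I P0 : ideal A) :
  noetherian A -> MaxAss (quotm I) P0 ->
  exists2 y, ~ (P0 : set A) y &
    forall P, MaxAss (quotm I) P -> (P : set A) <> P0 -> (P : set A) y.
Proof.
move=> noethA [AssP0 _]; have [P0prime _] := AssP0.
have [y P0y Ny] := localization_kernel_uniform I P0prime noethA.
exists y => // P [[_ [m Pm]] Pmax] PP0.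
have PE z : (P : set A) z <-> (I : set A) (z * repr m).
  rewrite Pm /annihilator /= -{1}(quotm_repr m) -quotm_piZ -quotm_pi0.
  by rewrite quotm_piP subr0.
apply/PE; apply: Ny.
(* By maximality of [P], some [z] in [P] avoids [P0]; it puts [repr m] in the kernel. *)
have /existsNP[z /not_implyP[Pz P0z]] : ~ (P `<=` P0).
  by move=> PsubP0; apply: PP0; rewrite (Pmax P0).
by exists z => //; apply/PE.
Qed.

Lemma regular_denominators_bigcap_MaxAss (A : comPzRingType) (I : ideal A) :
  noetherian A ->
  regular_denominators (bigcap_ideal (MaxAss (quotm I))) =
  ~` \bigcup_(P in MaxAss (quotm I)) (P : set A).
Proof.
move=> noethA; rewrite regular_denominatorsE; apply/seteqP; split=> a /=.
- move=> aJ [P0 P0max P0a].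
  have [y P0y yP] := MaxAss_separation noethA P0max.
  (* The product [a * y] lies in [P0] because of [a] and in every other prime because of [y];
     regularity of [a] then puts [y] in the intersection. *)
  apply: P0y; suff : colon (bigcap_ideal (MaxAss (quotm I))) a y.
    by rewrite aJ; exact.
  move=> P Pmax; have [_ _ PM] := idealP P.
  have [PP0|PP0] := pselect ((P : set A) = P0).
    by rewrite mulrC; apply: PM; rewrite PP0.
  by apply: PM; exact: yP.
- move=> aP; apply/seteqP; split=> x Jx P Pmax.
    have [[[_ Pprime] _] _] := Pmax.
    by have [Pa|//] := Pprime _ _ (Jx P Pmax); case: aP; exists P.
  by have [_ _ PM] := idealP P; apply: PM; exact: Jx.
Qed.

Theorem corollary3p4 (A : comPzRingType) (HA : noetherian A)
    (I : ideal A) (HI : is_proper I) :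
  regular_denominators I = regular_denominators (bigcap_ideal (MaxAss (quotm I))).
Proof.
by rewrite regular_denominators_MaxAss // regular_denominators_bigcap_MaxAss.
Qed.
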